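(* Let $f\in Y^*$, let $u\in X$ be the unique solution of $Bu=f$ in $Y^*$, and assume that there is a constant $c_S>0$ such that \[ c_S \, \| v_H \|_X \leq \sup_{0 \neq q_h \in Y_h} \frac{\langle B v_H , q_h \rangle_H}{\| q_h \|_Y} \qquad \text{for all } v_H \in X_H . \] Then for the unique solution $\widetilde{u}_H \in X_H$ of the perturbed variational formulation \[ \langle \widetilde{S} \widetilde{u}_H , v_H \rangle_H = \langle B^* p_{fh} , v_H \rangle_H \qquad \text{for all } v_H \in X_H \] there holds the error estimate \[ \| u -\widetilde{u}_H \|_X \leq \left( 1 + 2 \, \frac{[c_2^B]^2}{[c_S]^2} \right) \frac{c_2^B}{c_1^B} \inf_{v_H \in X_H} \| u - v_H \|_X + \frac{c_2^B}{[c_S]^2} \Big[ \inf_{q_h \in Y_h} \| p_u - q_h \|_Y + \inf_{q_h \in Y_h} \| p_f - q_h \|_Y \Big], \] where $p_u = A^{-1}Bu \in Y$ and $p_f = A^{-1} f\in Y$.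
   Context: All spaces are real. $X \subset H \subset X^*$ and $Y \subset H \subset Y^*$ are Gelfand triples of Hilbert spaces, where $X^*, Y^*$ are the duals of $X, Y$ with respect to $H$; $\langle \cdot,\cdot\rangle_H$ denotes the duality pairing (both for $Y^*\times Y$ and for $X^*\times X$, written in either order). $A : Y \to Y^*$ is a bounded linear operator that is self-adjoint and elliptic in $Y$, and $Y$ is equipped with the norm $\| q \|_Y := \sqrt{\langle A q, q\rangle_H}$; $Y^*$ carries the dual norm $\| f \|_{Y^*} := \sup_{0\neq q\in Y} \langle f,q\rangle_H / \| q \|_Y$. $B : X \to Y^*$ is a bounded linear operator which is surjective and for which there are positive constants $c_1^B, c_2^B$ such that for all $v\in X$ \[ \| B v \|_{Y^*} \leq c_2^B \| v \|_X, \qquad \sup_{0\neq q \in Y} \frac{\langle Bv,q\rangle_H}{\| q\|_Y} \geq c_1^B \| v\|_X ; \] thus $B$ is an isomorphism. $B^* : Y \to X^*$ is the adjoint, $\langle B^* q, v\rangle_H := \langle q, Bv\rangle_H$ for all $v\in X$, $q\in Y$. $X_H \subset X$ and $Y_h\subset Y$ are finite-dimensional subspaces (finite element spaces). For $w\in X$ let $p_{wh}\in Y_h$ be the unique solution of $\langle A p_{wh}, q_h\rangle_H = \langle Bw, q_h\rangle_H$ for all $q_h\in Y_h$, and define $\widetilde{S}w := B^* p_{wh}\in X^*$. For $f\in Y^*$ let $p_{fh}\in Y_h$ be the unique solution of $\langle A p_{fh}, q_h\rangle_H = \langle f, q_h\rangle_H$ for all $q_h\in Y_h$. *)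

(* Defs.v *)
From HB Require Import structures.
From mathcomp Require Import all_boot all_order all_algebra.
From mathcomp Require Import sesquilinear.
From mathcomp Require Import all_classical all_reals all_analysis.

Set Implicit Arguments.
Unset Strict Implicit.
Unset Printing Implicit Defensive.
Import Order.TTheory GRing.Theory Num.Theory.
Import numFieldNormedType.Exports.
Local Open Scope classical_set_scope.
Local Open Scope ring_scope.

HB.mixin Record CompleteNormedModule_isHilbert (R : realType) V
    of CompleteNormedModule R V := {
  dotp : {dot V for idfun} ;
  dotpp : forall v : V, dotp v v = `|v| ^+ 2
}.

#[short(type="hilbertType")]
HB.structure Definition Hilbert (R : realType) :=
  {V of CompleteNormedModule_isHilbert R V & CompleteNormedModule R V}.

Section Dual.
Context {R : realType} (V : normedModType R).

Definition dual_pred : {pred V -> R^o} :=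
  fun f => `[< linear f /\ continuous f >].

Fact dual_pred_submod : submod_closed dual_pred.
Proof.
split=> [|a f g /asboolP[lf cf] /asboolP[lg cg]]; apply/asboolP.
  split; last exact: cst_continuous.
  by move=> a u v; rewrite /= scaler0 addr0.
split=> [b u v|x].
  rewrite !fctE lf lg !scalerDr !scalerA mulrC -!addrA.
  by congr (_ + _); rewrite addrCA.
apply: (@continuousD _ _ _ (a \*: f) g); last exact: cg.
by apply: continuousZl_tmp; exact: cf.
Qed.

HB.instance Definition _ :=
  GRing.isSubmodClosed.Build R (V -> R^o) dual_pred dual_pred_submod.

Record dual : Type := Dual { dual_fun :> V -> R^o; _ : dual_fun \in dual_pred }.

HB.instance Definition _ := [isSub for dual_fun].
HB.instance Definition _ := [Choice of dual by <:].
HB.instance Definition _ := [SubChoice_isSubLmodule of dual by <:].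

Lemma dual_linear (f : dual) : linear f.
Proof. by case: f => f /= /asboolP[]. Qed.

Lemma dual_continuous (f : dual) : continuous f.
Proof. by case: f => f /= /asboolP[]. Qed.

HB.instance Definition _ (f : dual) :=
  GRing.isLinear.Build R V R^o *:%R f (dual_linear f).

Lemma dual_bounded (f : dual) : exists2 C, 0 < C & forall v, `|f v| <= C * `|v|.
Proof.
have /linear_bounded_continuous/linear_boundedP/pinfty_ex_gt0[C C0 fC] :=
  @dual_continuous f.
by exists C.
Qed.

Fact bounded_form_dual (f : V -> R^o) (C : R) :
  linear f -> (forall v, `|f v| <= C * `|v|) -> f \in dual_pred.
Proof.
move=> lf fC; apply/asboolP; split=> //.
pose F : {linear V -> R^o} := HB.pack f (GRing.isLinear.Build R V R^o *:%R f lf).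
apply: (@bounded_linear_continuous _ _ _ F); apply/linear_boundedP.
exists C; split; first exact: num_real.
by move=> r /ltW Cr v; rewrite (le_trans (fC v))// ler_wpM2r.
Qed.

(* In both suprema the convention of the library, sup set0 = 0, applies when
   there is no nonzero q. The norm N is a parameter because a Hilbert space can
   carry an energy norm besides its own norm. *)
Definition sup_quotient (N : V -> R) (E : set V) (f : dual) : R :=
  sup [set f q / N q | q in [set q | E q /\ q != 0]].

Definition dual_norm (N : V -> R) (f : dual) : R := sup_quotient N setT f.

Lemma dual_normP (f : dual) v : `|f v| <= dual_norm Num.norm f * `|v|.
Proof.
have [C C0 fC] := dual_bounded f.
have [->|v0] := eqVneq v 0; first by rewrite linear0 !normr0 mulr0.
have ub : has_sup [set f q / `|q| | q in [set q | setT q /\ q != 0]].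
  split; first by exists (f v / `|v|), v.
  exists C => _ [q [_ q0] <-]; rewrite ler_pdivrMr ?normr_gt0//.
  exact: le_trans (ler_norm _) (fC q).
have P w : w != 0 -> f w <= dual_norm Num.norm f * `|w|.
  move=> w0; rewrite -ler_pdivrMr ?normr_gt0//.
  by apply: ub_le_sup; [exact: ub.2|exists w].
by rewrite ler_norml lerNl -linearN -(normrN v) !P ?oppr_eq0// normrN P.
Qed.

Definition finite_dim_subspace (E : set V) : Prop :=
  exists (n : nat) (e : 'I_n -> V),
    E = [set \sum_i c i *: e i | c in [set: 'I_n -> R]].

Definition best_approx (N : V -> R) (E : set V) (v : V) : R :=
  inf [set N (v - e) | e in E].

End Dual.

Section GelfandTriple.
Context {R : realType}.

Lemma dotp_CS (H : hilbertType R) (u v : H) : `|dotp u v| <= `|u| * `|v|.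
Proof.
have [->|v0] := eqVneq v 0; first by rewrite linear0 !normr0 mulr0.
have v2 : 0 < `|v| ^+ 2 by rewrite exprn_gt0// normr_gt0.
have sym : dotp v u = dotp u v by rewrite hermitian_subproof expr0 mul1r.
have E (t : R) :
    0 <= `|u| ^+ 2 - t * dotp u v - (t * dotp u v - t * (t * `|v| ^+ 2)).
  have : 0 <= dotp (u - t *: v) (u - t *: v) by rewrite dotpp exprn_ge0.
  by rewrite linearBl !linearBr !linearZl_LR 2!linearZr_LR /= !dotpp sym.
have := E (dotp u v / `|v| ^+ 2).
rewrite divfK ?gt_eqF// subrr subr0 subr_ge0 mulrAC ler_pdivrMr// => h.
by rewrite -ler_sqr ?nnegrE ?mulr_ge0// exprMn real_normK ?num_real// expr2.
Qed.

(* V `<=` H `<=` dual V; the first inclusion is the map gelfand_emb, the second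
   one is gelfand_dual below. *)
Record gelfand_triple (V H : hilbertType R) := GelfandTriple {
  gelfand_emb :> {linear V -> H} ;
  gelfand_emb_continuous : continuous gelfand_emb ;
  gelfand_emb_inj : injective gelfand_emb ;
  gelfand_emb_dense : dense (range gelfand_emb)
}.

Variables (V H : hilbertType R) (T : gelfand_triple V H).

Fact gelfand_dual_subproof (h : H) : (fun v => dotp h (T v)) \in @dual_pred R V.
Proof.
have /linear_bounded_continuous/linear_boundedP/pinfty_ex_gt0[C C0 TC] :=
  @gelfand_emb_continuous _ _ T.
apply: (@bounded_form_dual _ _ _ (`|h| * C)) => [a u v|v].
  by rewrite !linearP.
by rewrite (le_trans (dotp_CS _ _))// -mulrA ler_wpM2l.
Qed.

(* The duality pairing of f : dual V and v : V is the value f v, so it extends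
   the inner product of H. *)
Definition gelfand_dual (h : H) : dual V := Dual (gelfand_dual_subproof h).

End GelfandTriple.

Section Operators.
Context {R : realType} (V W : normedModType R).
Implicit Types (T : {linear V -> dual W}).

Definition bounded_operator T : Prop :=
  exists C : R, forall v, dual_norm Num.norm (T v) <= C * `|v|.

Fact adjoint_subproof T (bT : bounded_operator T) (w : W) :
  (fun v => T v w) \in @dual_pred R V.
Proof.
have [C TC] := bT; apply: (@bounded_form_dual _ _ _ (C * `|w|)) => [a u v|v].
  by rewrite linearP.
by rewrite (le_trans (dual_normP _ _))// mulrAC ler_wpM2r.
Qed.

Definition adjoint T (bT : bounded_operator T) (w : W) : dual V :=
  Dual (adjoint_subproof bT w).

(* Total inverse, 0 where there is no preimage; single-valued when T is
   injective, as an elliptic T is. *)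
Definition operator_inv T (g : dual W) : V := xget 0 [set v | T v = g].

End Operators.

Section EllipticOperators.
Context {R : realType} (Y : normedModType R) (A : {linear Y -> dual Y}).

Definition self_adjoint (bA : bounded_operator A) : Prop :=
  forall q, adjoint bA q = A q.

Definition elliptic : Prop :=
  exists2 c : R, 0 < c & forall q, c * `|q| ^+ 2 <= A q q.

Definition energy_norm (q : Y) : R := Num.sqrt (A q q).

(* For elliptic A and finite-dimensional Yh this is the unique such p. *)
Definition discrete_sol (Yh : set Y) (g : dual Y) : Y :=
  xget 0 [set p | Yh p /\ forall q, Yh q -> A p q = g q].

Definition Stilde (X : normedModType R) (B : {linear X -> dual Y})
    (bB : bounded_operator B) (Yh : set Y) (w : X) : dual X :=
  adjoint bB (discrete_sol Yh (B w)).

End EllipticOperators.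

(* Main.v *)
(* Since B u = f, the discrete right-hand side p_fh is p_uh, so the perturbed
   equation is the Galerkin equation with exact solution u of the symmetric form
   s(w, v) = <A p_wh, p_vh>. The inf-sup condition makes s elliptic on XH with
   constant cS^2, and s is bounded by c2B^2, so Cea's lemma gives the estimate
   with constant 1 + (c2B / cS)^2 on the best approximation of u. The factor
   c2B / c1B is at least 1 unless X = 0, and the remaining terms are
   nonnegative. *)
Require Import Defs.
From HB Require Import structures.
From mathcomp Require Import all_boot all_order all_algebra.
From mathcomp Require Import all_classical all_reals all_analysis.
From mathcomp Require Import ring.

Set Implicit Arguments.
Unset Strict Implicit.
Unset Printing Implicit Defensive.
Import Order.TTheory GRing.Theory Num.Theory.
Import numFieldNormedType.Exports.
Local Open Scope classical_set_scope.
Local Open Scope ring_scope.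

(** * Pointwise evaluation of functionals *)

Lemma dualB (R : realType) (V : normedModType R) (f g : dual V) v :
  (f - g) v = f v - g v.
Proof. by []. Qed.

Lemma dualN (R : realType) (V : normedModType R) (f : dual V) v :
  (- f) v = - f v.
Proof. by []. Qed.

Lemma dualD (R : realType) (V : normedModType R) (f g : dual V) v :
  (f + g) v = f v + g v.
Proof. by []. Qed.

Lemma dualZ (R : realType) (V : normedModType R) k (f : dual V) v :
  (k *: f) v = k * f v.
Proof. by []. Qed.

(** * Galerkin equations on finite-dimensional subspaces *)

Section FiniteDimensionalSubspaces.
Context {R : realType} (V : normedModType R) (E : set V).
Hypothesis fdE : finite_dim_subspace E.

Lemma finite_dim_subspace0 : E 0.
Proof.
have [n [e ->]] := fdE; exists (fun=> 0) => //.
by rewrite big1// => i _; rewrite scale0r.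
Qed.

Lemma finite_dim_subspaceP (k : R) v w : E v -> E w -> E (k *: v + w).
Proof.
have [n [e ->]] := fdE => -[c _ <-] [d _ <-].
exists (fun i => k * c i + d i) => //.
rewrite scaler_sumr -big_split; apply: eq_bigr => i _ /=.
by rewrite scalerDl scalerA.
Qed.

Lemma finite_dim_subspaceB v w : E v -> E w -> E (v - w).
Proof.
by move=> Ev Ew; rewrite addrC -scaleN1r; exact: finite_dim_subspaceP.
Qed.

Lemma best_approx_ge0 (N : V -> R) v : (forall w, 0 <= N w) ->
  0 <= best_approx N E v.
Proof.
move=> N0; apply: lb_le_inf => [|_ [e _ <-]]; last exact: N0.
by exists (N (v - 0)), 0 => //; exact: finite_dim_subspace0.
Qed.

Lemma le_best_approx (N : V -> R) v x : (forall e, E e -> x <= N (v - e)) ->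
  x <= best_approx N E v.
Proof.
move=> xN; apply: lb_le_inf => [|_ [e Ee <-]]; last exact: xN.
by exists (N (v - 0)), 0 => //; exact: finite_dim_subspace0.
Qed.

Section Galerkin.
Variable a : {linear V -> dual V}.
(** Definiteness is asked on [E] only: for the perturbed operator the inf-sup condition yields it on
    [XH]. *)
Hypothesis a_def : forall v, E v -> a v v = 0 -> v = 0.

(** The difference [p - q] lies in [E], so the equations may be tested with it. *)
Lemma galerkin_unique p q : E p -> E q ->
  (forall v, E v -> a p v = a q v) -> p = q.
Proof.
move=> Ep Eq apq; have Epq := finite_dim_subspaceB Ep Eq.
apply/eqP; rewrite -subr_eq0; apply/eqP/a_def => //.
by rewrite (linearB a) dualB apq// subrr.
Qed.

(* The generators may be linearly dependent, so the Gram matrix may be singular;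
   its kernel consists of relations between the generators, which g respects. *)
Lemma galerkin_exists (g : dual V) :
  exists p, E p /\ forall v, E v -> a p v = g v.
Proof.
have [n [e defE]] := fdE.
pose G := \matrix_(i < n, j < n) a (e i) (e j).
pose b := \row_(j < n) g (e j).
have aE (c : 'I_n -> R) v : a (\sum_i c i *: e i) v = \sum_i c i * a (e i) v.
  elim/big_rec2 : _ => [|i x y _ <-]; first by rewrite linear0.
  by rewrite linearP.
have gE (h : dual V) (c : 'I_n -> R) :
    h (\sum_i c i *: e i) = \sum_i c i * h (e i).
  by rewrite linear_sum; apply: eq_bigr => i _; rewrite linearZ.
(* The system [c *m G = b] is solvable once [b] annihilates [cokermx G], whose columns [w] satisfy
   [G w = 0]. *)
have /submxP[c bG] : (b <= G)%MS.
  rewrite submxE; move: (cokermx G) (mulmx_coker G) => K GK.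
  apply/eqP/matrixP => i j; rewrite !mxE; pose w k := K k j.
  have Ew : E (\sum_k w k *: e k) by rewrite defE; exists w.
  have Gw k : \sum_l w l * a (e k) (e l) = 0.
    have /matrixP/(_ k j) := GK; rewrite !mxE; apply: etrans.
    by apply: eq_bigr => l _; rewrite !mxE mulrC.
  have w0 : \sum_k w k *: e k = 0.
    apply: a_def => //; rewrite aE big1// => k _.
    by rewrite gE Gw mulr0.
  transitivity (g (\sum_k w k *: e k)); last by rewrite w0 linear0.
  by rewrite gE; apply: eq_bigr => k _; rewrite !mxE mulrC.
exists (\sum_i c 0 i *: e i); rewrite defE; split; first by exists (c 0).
move=> _ [d _ <-]; rewrite !gE; apply: eq_bigr => j _; congr (_ * _).
have /matrixP/(_ 0 j) := bG; rewrite !mxE => ->; rewrite aE.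
by apply: eq_bigr => i _; rewrite mxE.
Qed.

End Galerkin.
End FiniteDimensionalSubspaces.

(** * The energy norm and its dual norm *)

Section EnergyNorm.
Context {R : realType} (Y : normedModType R) (A : {linear Y -> dual Y}).
Hypotheses (bA : bounded_operator A) (sA : self_adjoint bA) (eA : elliptic A).
Local Notation N := (energy_norm A).

Lemma self_adjoint_sym p q : A p q = A q p.
Proof. by rewrite -[in RHS]sA. Qed.

Lemma elliptic_ge0 q : 0 <= A q q.
Proof.
by have [c c0 /(_ q)] := eA; apply: le_trans; rewrite mulr_ge0// ?exprn_ge0// ltW.
Qed.

Lemma elliptic_def q : A q q = 0 -> q = 0.
Proof.
move=> Aq0; have [c c0 /(_ q)] := eA.
rewrite Aq0 pmulr_rle0// => q2; apply/eqP; rewrite -normr_eq0 -sqrf_eq0.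
by rewrite eq_le q2 exprn_ge0.
Qed.

Lemma energy_norm_ge0 q : 0 <= N q.
Proof. exact: sqrtr_ge0. Qed.

Lemma energy_norm0 : N 0 = 0.
Proof. by rewrite /energy_norm linear0 sqrtr0. Qed.

Lemma sqr_energy_norm q : N q ^+ 2 = A q q.
Proof. by rewrite sqr_sqrtr// elliptic_ge0. Qed.

Lemma energy_norm_gt0 q : q != 0 -> 0 < N q.
Proof.
move=> q0; rewrite lt_neqAle energy_norm_ge0 andbT eq_sym.
apply: contra q0 => /eqP Nq0; apply/eqP/elliptic_def.
by rewrite -sqr_energy_norm Nq0 expr0n.
Qed.

Lemma energy_CS p q : A p q <= N p * N q.
Proof.
have [->|q0] := eqVneq q 0.
  by rewrite linear0 mulr_ge0 ?energy_norm_ge0.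
have Nq := energy_norm_gt0 q0.
apply: le_trans (ler_norm _) _.
rewrite -ler_sqr ?nnegrE ?mulr_ge0 ?energy_norm_ge0// real_normK ?num_real//.
rewrite exprMn !sqr_energy_norm.
have Aq : 0 < A q q by rewrite -sqr_energy_norm exprn_gt0.
(* The minimiser of [A (p - t *: q) (p - t *: q)]; it cancels the last bracket of the expansion. *)
pose t := A p q / A q q.
have := elliptic_ge0 (p - t *: q).
have -> : A (p - t *: q) (p - t *: q)
    = A p p - t * A p q - t * (A p q - t * A q q).
  rewrite (linearB A) (linearZ_LR A) dualB dualZ !linearB !linearZ_LR /=.
  by rewrite (self_adjoint_sym q p).
by rewrite divfK ?gt_eqF// subrr mulr0 subr0 subr_ge0 mulrAC ler_pdivrMr.
Qed.

Lemma le_energy_dual_norm (g : dual Y) q : g q <= dual_norm N g * N q.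
Proof.
have [C C0 gC] := dual_bounded g; have [c c0 Ac] := eA.
have [->|q0] := eqVneq q 0.
  by rewrite linear0 energy_norm0 mulr0.
rewrite -ler_pdivrMr ?energy_norm_gt0//; apply: ub_le_sup; last by exists q.
(* The quotients are bounded, so the supremum dominates them: [|g v| <= C |v|], and ellipticity
   gives [sqrt c |v| <= N v]. *)
exists (C / Num.sqrt c) => _ [v [_ v0] <-].
rewrite ler_pdivrMr ?energy_norm_gt0// (le_trans (ler_norm _))//.
rewrite (le_trans (gC v))// -mulrA ler_pM2l// ler_pdivlMl ?sqrtr_gt0//.
rewrite -[`|v|]ger0_norm// -sqrtr_sqr -sqrtrM ?(ltW c0)//.
exact: ler_wsqrtr.
Qed.

(** * Linearity and stability of discrete solutions *)

Section DiscreteSolution.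
Variable Yh : set Y.
Hypothesis fdYh : finite_dim_subspace Yh.
Local Notation sol := (discrete_sol A Yh).

Lemma discrete_solP (g : dual Y) :
  Yh (sol g) /\ forall q, Yh q -> A (sol g) q = g q.
Proof.
have [p pP] := galerkin_exists fdYh (fun v _ => @elliptic_def v) g.
by apply: (@xgetPex _ 0 [set p | Yh p /\ forall q, Yh q -> A p q = g q]); exists p.
Qed.

Lemma discrete_sol_linear : linear sol.
Proof.
move=> k g h; have [[Eg gP] [Eh hP]] := (discrete_solP g, discrete_solP h).
have [E P] := discrete_solP (k *: g + h).
apply: (galerkin_unique fdYh (fun v _ => @elliptic_def v)) => //.
  exact: finite_dim_subspaceP.
by move=> q Eq; rewrite P// (linearD A) (linearZ_LR A) !dualD !dualZ gP// hP.
Qed.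

(** Testing the equation with its own solution [s] gives [N s ^+ 2 = g s]; one factor [N s]
    cancels. *)
Lemma energy_discrete_sol_le (g : dual Y) : N (sol g) <= dual_norm N g.
Proof.
have [E P] := discrete_solP g.
have [s0|s0] := eqVneq (sol g) 0; last first.
  rewrite -(ler_pM2r (energy_norm_gt0 s0)) -expr2 sqr_energy_norm P//.
  exact: le_energy_dual_norm.
(* The dual norm must be nonnegative: add its bounds at [q] and [- q], or use [sup set0 = 0] if [Y]
   is zero. *)
rewrite s0 energy_norm0.
have [[q q0]|Y0] := pselect (exists q : Y, q != 0).
  have Nq := energy_norm_gt0 q0.
  have NN : N (- q) = N q.
    by rewrite /energy_norm (linearN A) dualN linearN opprK.
  have h1 := le_energy_dual_norm g q; have := le_energy_dual_norm g (- q).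
  rewrite NN linearN => /(lerD h1).
  by rewrite subrr -mulrDl pmulr_lge0// -mulr2n pmulrn_lge0.
rewrite /dual_norm /sup_quotient (_ : [set _ | _ in _] = set0) ?sup0//.
by rewrite -subset0 => x [q [_ q0]]; case: Y0; exists q.
Qed.

(** On [Yh] the functional [g] agrees with [A (sol g)], so Cauchy-Schwarz bounds every quotient. *)
Lemma sup_quotient_le_energy (g : dual Y) : sup_quotient N Yh g <= N (sol g).
Proof.
have [E P] := discrete_solP g.
have [[q [Eq q0]]|Y0] := pselect (exists q : Y, Yh q /\ q != 0).
  apply: ge_sup; first by exists (g q / N q), q.
  move=> _ [v [Ev v0] <-].
  by rewrite ler_pdivrMr ?energy_norm_gt0// -P// energy_CS.
rewrite /sup_quotient (_ : [set _ | _ in _] = set0) ?sup0 ?energy_norm_ge0//.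
by rewrite -subset0 => x [q q0]; case: Y0; exists q.
Qed.

(** * The perturbed operator as a symmetric form *)

Section PerturbedOperator.
Context (X : normedModType R) (B : {linear X -> dual Y}).
Variable bB : bounded_operator B.
Local Notation S := (Stilde A bB Yh).

(** [S w v] is [B v] at [sol (B w)], an admissible test function in the equation defining
    [sol (B v)]. *)
Lemma StildeE w v : S w v = A (sol (B w)) (sol (B v)).
Proof.
have [[Ew _] [_ Pv]] := (discrete_solP (B w), discrete_solP (B v)).
by rewrite self_adjoint_sym Pv.
Qed.

Lemma Stilde_linear : linear S.
Proof.
move=> k v w; apply/val_inj/funext => x /=.
by rewrite /Stilde /= linearP discrete_sol_linear linearP.
Qed.

End PerturbedOperator.
End DiscreteSolution.
End EnergyNorm.

(** * Cea's estimate for the perturbed equation *)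

Theorem lemma2p4 (R : realType) (X Y H : hilbertType R)
  (TX : gelfand_triple X H) (TY : gelfand_triple Y H)
  (A : {linear Y -> dual Y}) (bA : bounded_operator A)
  (sA : self_adjoint bA) (eA : elliptic A)
  (B : {linear X -> dual Y}) (bB : bounded_operator B)
  (sB : forall g : dual Y, exists v : X, B v = g)
  (c1B c2B : R) (c1B_gt0 : 0 < c1B) (c2B_gt0 : 0 < c2B)
  (B_le : forall v : X, dual_norm (energy_norm A) (B v) <= c2B * `|v|)
  (B_ge : forall v : X,
     sup_quotient (energy_norm A) [set: Y] (B v) >= c1B * `|v|)
  (XH : set X) (Yh : set Y)
  (fdXH : finite_dim_subspace XH) (fdYh : finite_dim_subspace Yh)
  (f : dual Y) (u : X) (Bu : B u = f)
  (cS : R) (cS_gt0 : 0 < cS)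
  (infsup : forall vH : X, XH vH ->
     cS * `|vH| <= sup_quotient (energy_norm A) Yh (B vH)) :
  let p_fh := discrete_sol A Yh f in
  let p_u := operator_inv A (B u) in
  let p_f := operator_inv A f in
  let is_sol (uH : X) := XH uH /\
    forall vH : X, XH vH -> Stilde A bB Yh uH vH = adjoint bB p_fh vH in
  (exists! uH : X, is_sol uH) /\
  (forall uH : X, is_sol uH ->
     `|u - uH| <=
       (1 + 2 * (c2B ^+ 2 / cS ^+ 2)) * (c2B / c1B) * best_approx Num.norm XH u
       + c2B / cS ^+ 2 * (best_approx (energy_norm A) Yh p_u
                          + best_approx (energy_norm A) Yh p_f)).
Proof.
move=> p_fh p_u p_f is_sol.
pose S : {linear X -> dual X} := HB.pack (Stilde A bB Yh)
  (GRing.isLinear.Build R X (dual X) *:%R _ (Stilde_linear eA fdYh bB)).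
have SE w v : S w v = A (discrete_sol A Yh (B w)) (discrete_sol A Yh (B v)).
  exact: StildeE.
have S_ge v : XH v -> (cS * `|v|) ^+ 2 <= S v v.
  move=> Xv; rewrite SE -(sqr_energy_norm eA).
  rewrite ler_sqr ?nnegrE ?mulr_ge0 ?(ltW cS_gt0) ?energy_norm_ge0//.
  exact: le_trans (infsup _ Xv) (sup_quotient_le_energy sA eA fdYh _).
(* Boundedness is needed on all of [X], as it is applied to [u - v]. *)
have S_le w v : S w v <= (c2B * `|w|) * (c2B * `|v|).
  rewrite SE (le_trans (energy_CS sA eA _ _))// ler_pM ?energy_norm_ge0//.
    exact: le_trans (energy_discrete_sol_le eA fdYh _) (B_le w).
  exact: le_trans (energy_discrete_sol_le eA fdYh _) (B_le v).
have S_def v : XH v -> S v v = 0 -> v = 0.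
  move=> Xv Sv; have := S_ge v Xv; rewrite Sv => h.
  have : (cS * `|v|) ^+ 2 == 0 by rewrite eq_le h sqr_ge0.
  by rewrite sqrf_eq0 mulf_eq0 gt_eqF//= normr_eq0 => /eqP.
have rhsE : adjoint bB p_fh = S u by rewrite /p_fh -Bu.
split.
  have [p [Xp pP]] := galerkin_exists fdXH S_def (adjoint bB p_fh).
  exists p; split=> [//|q [Xq qP]].
  by apply: (galerkin_unique fdXH S_def) => // v Xv; rewrite pP// -qP.
move=> uH [XuH uHP].
have K0 : 0 <= c2B ^+ 2 / cS ^+ 2 by rewrite divr_ge0 ?sqr_ge0.
(* Triangle inequality through [v]; it remains to bound the discrete part [uH - v]. *)
have cea v : XH v -> `|u - uH| <= (1 + c2B ^+ 2 / cS ^+ 2) * `|u - v|.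
  move=> Xv; have Xd := finite_dim_subspaceB fdXH XuH Xv.
  rewrite -(subrKA v) (le_trans (ler_normD _ _))// mulrDl mul1r lerD2l distrC.
  have [->|d0] := eqVneq (uH - v) 0.
    by rewrite normr0 mulr_ge0.
  have d_gt0 : 0 < `|uH - v| by rewrite normr_gt0.
  (* Galerkin orthogonality: [S uH] and [S u] agree on [XH]. *)
  have orth : S (uH - v) (uH - v) = S (u - v) (uH - v).
    by rewrite !(linearB S) !dualB uHP// rhsE.
  have := S_ge _ Xd; rewrite orth => /le_trans /(_ (S_le _ _)) h.
  rewrite mulrAC ler_pdivlMr ?exprn_gt0// -(ler_pM2r d_gt0).
  have -> : `|uH - v| * cS ^+ 2 * `|uH - v| = (cS * `|uH - v|) ^+ 2 by ring.
  by rewrite (le_trans h)// le_eqVlt; apply/orP; left; apply/eqP; ring.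
(* Both bounds on [B] concern the same supremum, so [c1B |v| <= c2B |v|]. *)
have c12 (v : X) : `|v| <= c2B / c1B * `|v|.
  rewrite mulrAC ler_pdivlMr// [leLHS]mulrC.
  exact: le_trans (B_ge v) (B_le v).
have C0 : 0 < (1 + 2 * (c2B ^+ 2 / cS ^+ 2)) * (c2B / c1B).
  by rewrite mulr_gt0 ?divr_gt0// ltr_pwDl// mulr_ge0.
rewrite -[leLHS]addr0 lerD//; last first.
  rewrite mulr_ge0 ?divr_ge0 ?exprn_ge0 ?(ltW c2B_gt0) ?(ltW cS_gt0)//.
  by rewrite addr_ge0// best_approx_ge0//; exact: energy_norm_ge0.
(* Dividing by the positive constant reduces the infimum to a bound for each [v] in [XH]. *)
rewrite mulrC -ler_pdivrMr//; apply: le_best_approx => // v Xv.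
rewrite ler_pdivrMr// mulrC (le_trans (cea v Xv))// -[leRHS]mulrA.
by apply: ler_pM => //; [exact: addr_ge0|rewrite lerD2l mulr_natl mulr2n lerDl].
Qed.
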